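(* Fix $c\in(0,1]$. For a function $W:\mathbb{N}\to\mathbb{R}$ and an integer $n\ge 2$, say $W$ is admissible with curvature at most $c$ (relative to $n$) if $W(0)=0$, $W(x)>0$ for all $x\ge1$, $W$ is nondecreasing and concave on $\{0,1,2,\dots\}$, and $1-\frac{W(n)-W(n-1)}{W(1)}\le c$. (a) For every $n\ge 2$, consider the utility mechanism that assigns to every resource $r$ with welfare function $W_r$ the local utility function $$F_r(x)=\sum_{k=1}^n \eta_k(W_r)\,F^c_k(x),\qquad x=1,\dots,n,$$ where $\eta_1(W)=[2W(1)-W(2)]/c$, $\eta_k(W)=[2W(k)-W(k-1)-W(k+1)]/c$ for $k=2,\dots,n-1$, $\eta_n(W)=W(1)-\sum_{k=1}^{n-1}\eta_k(W)$, and $F^c_k$ is the function defined by $F^c_k(1)=1$ and, for $x\ge1$, $$F^c_k(x+1)=\max\Big\{\tfrac1k\big[xF^c_k(x)-V^c_k(x)\rho_k\big]+1,\;1-c\Big\},\qquad \rho_k=\Big(1-c\,\tfrac{k^ke^{-k}}{k!}\Big)^{-1},$$ with $V^c_k(x)=(1-c)x+c\min\{x,k\}$. Then every resource allocation game with at most $n$ players whose welfare functions are all admissible with curvature at most $c$ (relative to $n$), equipped with this mechanism, has price of anarchy at least $1-c/e$. (b) Conversely, for every utility mechanism $\mathcal{F}$, the infimum of the price of anarchy over all resource allocation games (with any finite number of players $n$) whose welfare functions are admissible with curvature at most $c$ (relative to their number of players) is at most $1-c/e$. Hence the best achievable price of anarchy over this class is exactly $1-c/e$.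
   Context: A resource allocation game consists of a finite player set $N=\{1,\dots,n\}$, a finite resource set $\mathcal{R}$, action sets $\mathcal{A}_i\subseteq 2^{\mathcal{R}}$ for each $i\in N$, welfare functions $W_r:\mathbb{N}\to\mathbb{R}$ and local utility functions $F_r:\mathbb{N}\to\mathbb{R}$ for $r\in\mathcal{R}$. For an allocation $a=(a_1,\dots,a_n)\in\mathcal{A}=\prod_i\mathcal{A}_i$, let $|a|_r=|\{i\in N: r\in a_i\}|$. The system welfare is $W(a)=\sum_{r\in\cup_i a_i}W_r(|a|_r)$ and player $i$'s utility is $U_i(a)=\sum_{r\in a_i}F_r(|a|_r)$. A pure Nash equilibrium is an $a^{ne}\in\mathcal{A}$ with $U_i(a^{ne})\ge U_i(a_i,a^{ne}_{-i})$ for all $a_i\in\mathcal{A}_i$, $i\in N$. The price of anarchy of a game $G$ is $\mathrm{PoA}(G)=\min_{a\in\mathrm{NE}(G)}W(a)/\max_{a\in\mathcal{A}}W(a)$, and of a set of games is the infimum over the set. A utility mechanism is a map $\mathcal{F}$ assigning to each welfare function $W_r$ a local utility function $F_r=\mathcal{F}(W_r)$. *)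

(* Defs.v *)
From HB Require Import structures.
From mathcomp Require Import all_boot all_order all_algebra.
From mathcomp Require Import classical_sets reals.
From mathcomp Require Import sequences.
Set Implicit Arguments. Unset Strict Implicit. Unset Printing Implicit Defensive.
Import Order.TTheory GRing.Theory Num.Theory.
Local Open Scope ring_scope.

Section Games.
Variable R : realType.

Definition load (m : nat) (Rs : finType) (a : {ffun 'I_m -> {set Rs}}) (r : Rs) : nat :=
  #|[set i | r \in a i]|.

Definition feasible (m : nat) (Rs : finType) (A : 'I_m -> {set {set Rs}})
  (a : {ffun 'I_m -> {set Rs}}) : bool := [forall i, a i \in A i].

Definition welfare (m : nat) (Rs : finType) (W : Rs -> nat -> R)
  (a : {ffun 'I_m -> {set Rs}}) : R :=
  \sum_(r | [exists i, r \in a i]) W r (load a r).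

Definition utility (m : nat) (Rs : finType) (F : Rs -> nat -> R)
  (a : {ffun 'I_m -> {set Rs}}) (i : 'I_m) : R :=
  \sum_(r in a i) F r (load a r).

Definition upd (m : nat) (Rs : finType) (a : {ffun 'I_m -> {set Rs}}) (i : 'I_m)
  (b : {set Rs}) : {ffun 'I_m -> {set Rs}} :=
  [ffun j => if j == i then b else a j].

Definition is_NE (m : nat) (Rs : finType) (A : 'I_m -> {set {set Rs}})
  (F : Rs -> nat -> R) (a : {ffun 'I_m -> {set Rs}}) : bool :=
  feasible A a &&
  [forall i, [forall b in A i, utility F (upd a i b) i <= utility F a i]].

Definition opt_welfare (m : nat) (Rs : finType) (A : 'I_m -> {set {set Rs}})
  (W : Rs -> nat -> R) : R :=
  \big[Num.max/0]_(a : {ffun 'I_m -> {set Rs}} | feasible A a) welfare W a.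

Definition worst_NE_welfare (m : nat) (Rs : finType) (A : 'I_m -> {set {set Rs}})
  (W : Rs -> nat -> R) (F : Rs -> nat -> R) : R :=
  \big[Num.min/opt_welfare A W]_(a : {ffun 'I_m -> {set Rs}} | is_NE A F a) welfare W a.

Definition PoA (m : nat) (Rs : finType) (A : 'I_m -> {set {set Rs}})
  (W : Rs -> nat -> R) (F : Rs -> nat -> R) : R :=
  if opt_welfare A W == 0 then 1 else worst_NE_welfare A W F / opt_welfare A W.

Definition admissible (c : R) (n : nat) (W : nat -> R) : Prop :=
  [/\ W 0%N = 0,
      (forall x : nat, (1 <= x)%N -> 0 < W x),
      (forall x : nat, W x <= W x.+1),
      (forall x : nat, W x.+2 - W x.+1 <= W x.+1 - W x) &
      1 - (W n - W n.-1) / W 1%N <= c].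

Definition rho (c : R) (k : nat) : R :=
  (1 - c * ((k%:R) ^+ k * expR (- k%:R) / (k`!)%:R))^-1.

Definition Vc (c : R) (k x : nat) : R := (1 - c) * x%:R + c * (minn x k)%:R.

(* Fcs c k x = F^c_k (x+1) *)
Fixpoint Fcs (c : R) (k x : nat) : R :=
  match x with
  | 0 => 1
  | x'.+1 => Num.max ((k%:R)^-1 * (x%:R * Fcs c k x' - Vc c k x * rho c k) + 1) (1 - c)
  end.

(* F^c_k(x) for x >= 1 (value at 0 irrelevant, set to 0) *)
Definition Fc (c : R) (k x : nat) : R :=
  match x with 0 => 0 | x'.+1 => Fcs c k x' end.

Definition eta_pre (c : R) (W : nat -> R) (k : nat) : R :=
  if k == 1%N then (2 * W 1%N - W 2%N) / c
  else (2 * W k - W k.-1 - W k.+1) / c.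

Definition eta (c : R) (n : nat) (W : nat -> R) (k : nat) : R :=
  if k == n then W 1%N - \sum_(1 <= j < n) eta_pre c W j else eta_pre c W k.

Definition mech (c : R) (n : nat) (W : nat -> R) : nat -> R :=
  fun x => \sum_(1 <= k < n.+1) eta c n W k * Fc c k x.

End Games.

(* Main.v *)
(* (a) A welfare function admissible up to [n] is a nonnegative combination, with
   coefficients [eta_k], of the functions [V_k = Vc c k] on [0..n], and the
   mechanism is linear, so it suffices to prove the smoothness inequality
     V_k(b+x) + a F_k(a+x) - b F_k(a+x+1) <= rho_k V_k(a+x).
   Since [F_k] is nonincreasing and lies between [1 - c] and [1], this reduces to
   the recursion that defines [F_k]. Monotonicity comes from solving the
   recursion in terms of the partial sums and tails of the series of [exp k];
   the constant [rho_k] is exactly the one for which the growing mode of the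
   recursion vanishes, so that its maximum with [1 - c] is never active.
   Summing over the resources gives [opt <= rho_1 * W(ne)], as [rho_k <= rho_1].
   (b) Only [W = V_1] is needed. By cyclic symmetry, a single game per number of
   players has the same bad equilibrium whatever the utility function [F(V_1)]
   is, and its efficiency tends to [1 - c/e]. *)
Require Import Defs.
From HB Require Import structures.
From mathcomp Require Import all_boot all_order all_algebra.
From mathcomp Require Import classical_sets reals.
From mathcomp Require Import sequences.
From mathcomp Require Import boolp topology normedtype exp.
From mathcomp Require Import ring lra.
Set Implicit Arguments. Unset Strict Implicit. Unset Printing Implicit Defensive.
Import Order.TTheory GRing.Theory Num.Theory.
Local Open Scope ring_scope.
Local Open Scope classical_set_scope.

(** * Partial sums and tails of the exponential series, and Poisson weights *)

Section ExponentialSeries.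
Context {R : realType}.
Implicit Types (x : R) (k j n : nat).

Definition exp_partial x n : R := \sum_(0 <= i < n) x ^+ i / i`!%:R.

Lemma exp_partialS x n : exp_partial x n.+1 = exp_partial x n + x ^+ n / n`!%:R.
Proof. by rewrite /exp_partial big_nat_recr. Qed.

Lemma fact_gt0R n : 0 < n`!%:R :> R.
Proof. by rewrite ltr0n fact_gt0. Qed.

Lemma exp_partial_ge0 x n : 0 <= x -> 0 <= exp_partial x n.
Proof. by move=> x0; apply: sumr_ge0 => i _; rewrite divr_ge0 ?exprn_ge0. Qed.

Lemma exp_partial_le x n : 0 <= x -> exp_partial x n <= expR x.
Proof.
move=> x0; apply: (@nondecreasing_cvgn_le _ (series (exp_coeff x))); last first.
  exact: is_cvg_series_exp_coeff.
by apply/nondecreasing_seqP => m; rewrite -subr_ge0 seriesSB exp_coeff_ge0.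
Qed.

(* The tail of the exponential series is dominated by the geometric series of
   ratio [x / n.+1]; the bound is stated so that it telescopes. *)
Lemma expR_le_partial x n : 0 <= x -> x < n.+1%:R ->
  expR x <= exp_partial x n.+1 + x ^+ n / n`!%:R * (x / (n.+1%:R - x)).
Proof.
move=> x0 xn; apply: limr_le; first exact: is_cvg_series_exp_coeff.
have step m : x < m.+1%:R ->
    exp_partial x m.+2 + x ^+ m.+1 / m.+1`!%:R * (x / (m.+2%:R - x)) <=
    exp_partial x m.+1 + x ^+ m / m`!%:R * (x / (m.+1%:R - x)).
  move=> xm; rewrite exp_partialS -addrA lerD2l factS natrM exprS.
  have m1 : 0 < m.+1%:R :> R by rewrite ltr0n.
  have m2 : 0 < m.+2%:R - x :> R by rewrite -(@natr1 _ m.+1); lra.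
  have m3 : 0 < m.+1%:R - x :> R by lra.
  have f0 := fact_gt0R m.
  have -> : x * x ^+ m / (m.+1%:R * m`!%:R) +
      x * x ^+ m / (m.+1%:R * m`!%:R) * (x / (m.+2%:R - x)) =
      x ^+ m / m`!%:R * (x * (m.+2%:R / (m.+1%:R * (m.+2%:R - x)))).
    by field; rewrite !gt_eqF //; lra.
  rewrite ler_wpM2l ?divr_ge0 ?exprn_ge0// ler_wpM2l//.
  rewrite ler_pdivrMr ?mulr_gt0// ler_pdivlMl//.
  by rewrite -!(@natr1 _ m.+1); nra.
have bnd d : exp_partial x (n + d).+1 +
      x ^+ (n + d) / (n + d)`!%:R * (x / ((n + d).+1%:R - x)) <=
    exp_partial x n.+1 + x ^+ n / n`!%:R * (x / (n.+1%:R - x)).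
  elim: d => [|d IH]; first by rewrite addn0.
  rewrite addnS; apply: le_trans IH; apply: step.
  by apply: lt_le_trans xn _; rewrite ler_nat ltnS leq_addr.
exists n.+1 => //= m /= nm.
have -> : m = (n + (m - n.+1)).+1 by rewrite -addSn subnKC.
apply: le_trans (bnd (m - n.+1)%N).
rewrite -[leLHS]/(exp_partial x _) lerDl mulr_ge0 ?divr_ge0 ?exprn_ge0//.
rewrite subr_ge0; apply: le_trans (ltW xn) _.
by rewrite ler_nat ltnS leq_addr.
Qed.

(* [k^j/j!] times these quantities are the parts of the series of [exp k] of
   indices [< j] and [> j]. *)
Definition exp_head k j : R := j`!%:R / k%:R ^+ j * exp_partial k%:R j.
Definition exp_tail k j : R :=
  j`!%:R / k%:R ^+ j * (expR k%:R - exp_partial k%:R j.+1).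

Section PositiveArgument.
Variables (k : nat) (k_gt0 : (0 < k)%N).

Let kR_gt0 : 0 < k%:R :> R. Proof. by rewrite ltr0n. Qed.

Lemma exp_head0 : exp_head k 0 = 0.
Proof. by rewrite /exp_head /exp_partial big_geq// mulr0. Qed.

Lemma exp_headS j : exp_head k j.+1 = j.+1%:R / k%:R * (exp_head k j + 1).
Proof.
rewrite /exp_head exp_partialS factS natrM exprS.
have f0 := fact_gt0R j; have e0 : 0 < k%:R ^+ j :> R by rewrite exprn_gt0.
by field; rewrite !gt_eqF //; lra.
Qed.

Lemma exp_tailS j : exp_tail k j.+1 = j.+1%:R / k%:R * exp_tail k j - 1.
Proof.
rewrite /exp_tail (exp_partialS _ j.+1) factS natrM exprS.
have f0 := fact_gt0R j; have e0 : 0 < k%:R ^+ j :> R by rewrite exprn_gt0.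
by have j0 := ler0n R j; field; rewrite !gt_eqF //; lra.
Qed.

Lemma exp_head_tail j :
  exp_head k j + exp_tail k j + 1 = j`!%:R / k%:R ^+ j * expR k%:R.
Proof.
rewrite /exp_tail /exp_head exp_partialS.
have f0 := fact_gt0R j; have e0 : 0 < k%:R ^+ j :> R by rewrite exprn_gt0.
by field; rewrite !gt_eqF //; lra.
Qed.

Lemma exp_head_ge0 j : 0 <= exp_head k j.
Proof. by rewrite mulr_ge0 ?divr_ge0 ?exprn_ge0 ?exp_partial_ge0. Qed.

Lemma exp_tail_ge0 j : 0 <= exp_tail k j.
Proof. by rewrite mulr_ge0 ?divr_ge0 ?exprn_ge0 ?subr_ge0 ?exp_partial_le. Qed.

Lemma exp_head_leS j : exp_head k j <= exp_head k j.+1.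
Proof.
elim: j => [|j IH]; first by rewrite exp_head0 exp_head_ge0.
rewrite [leRHS]exp_headS [leLHS]exp_headS.
have := exp_head_ge0 j.
by move=> h0; rewrite ler_pM ?divr_ge0 ?addr_ge0// ?lerD2r// ler_pM2r ?invr_gt0// ler_nat.
Qed.

Lemma exp_head_le i j : (i <= j)%N -> exp_head k i <= exp_head k j.
Proof. by move: i j; apply/nondecreasing_seqP; exact: exp_head_leS. Qed.

(** By the recursion [exp_tailS], the decrease amounts to [exp_tail k j <= k / (j + 1 - k)], which
    is the geometric bound [expR_le_partial] at [x = k]. *)
Lemma exp_tail_leS j : (k <= j)%N -> exp_tail k j.+1 <= exp_tail k j.
Proof.
move=> kj; have kj1 : 0 < j.+1%:R - k%:R :> R by rewrite subr_gt0 ltr_nat ltnS.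
have tail_le : exp_tail k j <= k%:R / (j.+1%:R - k%:R).
  have f0 := fact_gt0R j; have e0 : 0 < k%:R ^+ j :> R by rewrite exprn_gt0.
  have -> : k%:R / (j.+1%:R - k%:R) = j`!%:R / k%:R ^+ j *
      (k%:R ^+ j / j`!%:R * (k%:R / (j.+1%:R - k%:R))) :> R.
    by field; rewrite !gt_eqF //; lra.
  rewrite ler_wpM2l ?divr_ge0 ?exprn_ge0// lerBlDl expR_le_partial//.
  by rewrite ltr_nat ltnS.
rewrite exp_tailS lerBlDl -lerBlDr.
have -> : j.+1%:R / k%:R * exp_tail k j - exp_tail k j =
    (j.+1%:R - k%:R) / k%:R * exp_tail k j by field; rewrite gt_eqF.
by rewrite mulrC -ler_pdivlMr ?divr_gt0// div1r invf_div.
Qed.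

End PositiveArgument.

End ExponentialSeries.

(** The value at [k = 1] is [1/e], and passing from [k] to [k + 1] multiplies it by
    [(1 + 1/k)^k / e], which is at most 1. *)
Lemma poisson_mode_le {R : realType} (k : nat) : (0 < k)%N ->
  k%:R ^+ k * expR (- k%:R) / k`!%:R <= (expR 1)^-1 :> R.
Proof.
case: k => // k _; elim: k => [|k IH].
  by rewrite expr1 mul1r divr1 expRN.
apply: le_trans IH.
have k1 : 0 < k.+1%:R :> R by rewrite ltr0n.
have k2 : 0 < k.+2%:R :> R by rewrite ltr0n.
have f0 := @fact_gt0R R k.+1.
have -> : - k.+2%:R = - k.+1%:R - 1 :> R by rewrite -(@natr1 _ k.+1) opprD.
rewrite expRD expRN exprS (factS k.+1) natrM.
have -> : k.+2%:R * k.+2%:R ^+ k.+1 * ((expR k.+1%:R)^-1 * expR (-1)) /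
    (k.+2%:R * k.+1`!%:R) =
    k.+1%:R ^+ k.+1 * (expR k.+1%:R)^-1 / k.+1`!%:R *
    ((1 + k.+1%:R^-1) ^+ k.+1 * expR (-1)) :> R.
  have -> : 1 + k.+1%:R^-1 = k.+2%:R / k.+1%:R :> R.
    by rewrite -(@natr1 _ k.+1) mulrDl mulfV ?mul1r// gt_eqF.
  rewrite expr_div_n.
  move: (k.+1%:R) (k.+2%:R) (k.+1`!%:R) k1 k2 f0 => y z f y0 z0 f0; field.
  by rewrite !gt_eqF ?exprn_gt0 ?expR_gt0.
rewrite ger_pMr; last by rewrite divr_gt0 ?mulr_gt0 ?exprn_gt0 ?invr_gt0 ?expR_gt0.
rewrite expRN ler_pdivrMr ?expR_gt0// mul1r.
have -> : expR 1 = expR (k.+1%:R^-1) ^+ k.+1 :> R.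
  by rewrite -expRM_natl mulfV// gt_eqF.
by rewrite lerXn2r ?nnegrE ?expR_ge0 ?expR_ge1Dx ?addr_ge0 ?invr_ge0.
Qed.

Lemma poisson_mode_lt1 {R : realType} (k : nat) : (0 < k)%N ->
  k%:R ^+ k * expR (- k%:R) / k`!%:R < 1 :> R.
Proof.
move=> k0; apply: le_lt_trans (poisson_mode_le k0) _.
by rewrite invf_lt1 ?expR_gt0// expR_gt1.
Qed.

(** * The basis utilities: closed form, monotonicity and smoothness *)

Section BasisUtility.
Context {R : realType}.
Variables (c : R) (k : nat).
Hypotheses (c_gt0 : 0 < c) (c_le1 : c <= 1) (k_gt0 : (0 < k)%N).

Let q : R := k%:R ^+ k * expR (- k%:R) / k`!%:R.
(** Chosen so that [rho c k = 1 + c * s]; equivalently [1 / s = 1 / q - c]. *)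
Let s : R := q / (1 - c * q).

Let kR_gt0 : 0 < k%:R :> R. Proof. by rewrite ltr0n. Qed.

Let q_gt0 : 0 < q.
Proof. by rewrite divr_gt0 ?mulr_gt0 ?exprn_gt0 ?expR_gt0 ?fact_gt0R. Qed.

Let cq_lt1 : 0 < 1 - c * q.
Proof.
have q1 : q < 1 := poisson_mode_lt1 k_gt0.
by rewrite subr_gt0 (le_lt_trans _ q1)// ger_pMl.
Qed.

Let s_gt0 : 0 < s. Proof. by rewrite divr_gt0. Qed.

Let rhoE : rho c k = 1 + c * s.
Proof. by rewrite /rho -/q /s; field; rewrite gt_eqF. Qed.

Let s_head_tail : s * (exp_head k k + exp_tail k k + 1 - c) = 1.
Proof.
have -> : exp_head k k + exp_tail k k + 1 = q^-1.
  rewrite exp_head_tail// /q expRN; field.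
  by rewrite !gt_eqF ?exprn_gt0 ?expR_gt0 ?fact_gt0R.
by rewrite /s; field; rewrite !gt_eqF.
Qed.

(** For these indices [Vc] is the identity and the recursion becomes that of [exp_head]. The maximum
    is inactive because [s * exp_head k j <= s * exp_head k k <= 1], by [s_head_tail]. *)
Lemma Fcs_head j : (j <= k)%N -> Fcs c k j = 1 - c * s * exp_head k j.
Proof.
elim: j => [|j IH] jk; first by rewrite /= exp_head0 mulr0 subr0.
rewrite [LHS]/= IH ?(ltnW jk)// rhoE /Vc (minn_idPl jk).
have -> : k%:R^-1 * (j.+1%:R * (1 - c * s * exp_head k j) -
    ((1 - c) * j.+1%:R + c * j.+1%:R) * (1 + c * s)) + 1 =
    1 - c * s * exp_head k j.+1.
  by rewrite exp_headS//; field; rewrite gt_eqF.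
apply/max_idPl; rewrite lerD2l lerN2 -mulrA ger_pMr//.
rewrite -s_head_tail ler_pM2l// (le_trans (exp_head_le k_gt0 jk))//.
by rewrite -!addrA lerDl addr_ge0 ?exp_tail_ge0// subr_ge0.
Qed.

(** At [j = k] this agrees with [Fcs_head] exactly by [s_head_tail]; afterwards the recursion is
    that of [exp_tail], with no multiple of the growing solution [j! / k^j] added. Nonnegativity of
    the tail keeps the maximum inactive. *)
Lemma Fcs_tail j : (k <= j)%N ->
  Fcs c k j = 1 - c + c * s * (exp_tail k j + 1 - c).
Proof.
move=> /subnKC <-; elim: (j - k)%N => [|d IH].
  rewrite addn0 Fcs_head//.
  apply/eqP; rewrite -subr_eq0.
  have -> : 1 - c * s * exp_head k k - (1 - c + c * s * (exp_tail k k + 1 - c)) =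
      c * (1 - s * (exp_head k k + exp_tail k k + 1 - c)) by ring.
  by rewrite s_head_tail subrr mulr0.
rewrite addnS [LHS]/= IH rhoE /Vc (minn_idPr (leqW (leq_addr _ _))).
have -> : k%:R^-1 * ((k + d).+1%:R *
      (1 - c + c * s * (exp_tail k (k + d) + 1 - c)) -
    ((1 - c) * (k + d).+1%:R + c * k%:R) * (1 + c * s)) + 1 =
    1 - c + c * s * (exp_tail k (k + d).+1 + 1 - c).
  by rewrite exp_tailS//; move: (_.+1%:R) => y; field; rewrite gt_eqF.
apply/max_idPl; rewrite lerDl mulr_ge0 ?(ltW (mulr_gt0 c_gt0 s_gt0))//.
by rewrite -addrA addr_ge0 ?exp_tail_ge0// subr_ge0.
Qed.

Lemma Fcs_leS j : Fcs c k j.+1 <= Fcs c k j.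
Proof.
have cs0 : 0 < c * s by rewrite mulr_gt0.
have [jk|kj] := ltnP j k.
  by rewrite !Fcs_head ?(ltnW jk)// lerD2l lerN2 ler_pM2l// exp_head_leS.
rewrite !Fcs_tail ?(leqW kj)// lerD2l ler_pM2l// !lerD2r.
exact: exp_tail_leS.
Qed.

Lemma Fcs_le1 j : Fcs c k j <= 1.
Proof. by elim: j => // j; apply: le_trans; exact: Fcs_leS. Qed.

Lemma Fcs_ge j : 1 - c <= Fcs c k j.
Proof.
have c0 := c_gt0; case: j => [|j] /=; first by lra.
by rewrite le_max lexx orbT.
Qed.

Lemma Vc_ge0 x : 0 <= Vc c k x.
Proof. by rewrite addr_ge0 ?mulr_ge0 ?subr_ge0 ?(ltW c_gt0). Qed.

(* [Fc c k] is defined so that equality holds at [l = k]; the left-hand side is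
   increasing in [l] up to [k] because [Fc <= 1] and decreasing afterwards
   because [Fc >= 1 - c]. *)
Lemma Vc_Fc_disjoint j l : Vc c k l + j%:R * Fc c k j - l%:R * Fc c k j.+1 <=
  rho c k * Vc c k j.
Proof.
have VcE : Vc c k k = k%:R by rewrite /Vc minnn; ring.
have Vk : Vc c k l - l%:R * Fc c k j.+1 <= k%:R - k%:R * Fc c k j.+1.
  have c0 := c_gt0; have c1 := c_le1; have F1 := Fcs_le1 j; have Fge := Fcs_ge j; rewrite /Vc /=.
  have [lk|kl] := leqP l k.
    have : l%:R <= k%:R :> R by rewrite ler_nat.
    by move=> ?; nra.
  have : k%:R <= l%:R :> R by rewrite ler_nat ltnW.
  by move=> ?; nra.
suff: k%:R - k%:R * Fc c k j.+1 + j%:R * Fc c k j <= rho c k * Vc c k j.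
  by move=> h; lra.
case: j {Vk} => [|j].
  have -> : Vc c k 0 = 0 by rewrite /Vc min0n !mulr0 addr0.
  by rewrite /= !mulr0 addr0 mulr1 subrr.
have : k%:R^-1 * (j.+1%:R * Fcs c k j - Vc c k j.+1 * rho c k) + 1 <=
    Fcs c k j.+1 by rewrite le_max lexx.
rewrite -lerBrDr ler_pdivrMl// /Fc => h; lra.
Qed.

(** Compared with [Vc_Fc_disjoint] at [j = a + x] and [l = b + x], the left-hand side only loses
    [x * (F(a+x) - F(a+x+1)) >= 0]. *)
Lemma Vc_Fc_smooth a b x : Vc c k (b + x) + a%:R * Fc c k (a + x) -
  b%:R * Fc c k (a + x).+1 <= rho c k * Vc c k (a + x).
Proof.
apply: le_trans (Vc_Fc_disjoint _ (b + x)).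
(* Load 0 is separate: the conventional value [Fc c k 0 = 0] breaks monotonicity there. *)
have [ax0|ax0] := posnP (a + x).
  have /andP[/eqP -> /eqP ->] : (a == 0) && (x == 0) by rewrite -addn_eq0 ax0.
  by rewrite !addn0.
rewrite !natrD; have : Fc c k (a + x).+1 <= Fc c k (a + x).
  by rewrite -(prednK ax0); exact: Fcs_leS.
have h := ler0n R x; nra.
Qed.

Lemma rho_le : rho c k <= (1 - c / expR 1)^-1.
Proof.
have q_le : q <= (expR 1)^-1 := poisson_mode_le k_gt0.
have e1 : (expR 1)^-1 < 1 :> R by rewrite invf_lt1 ?expR_gt0// expR_gt1.
rewrite lef_pV2 ?posrE//; last by have c0 := c_gt0; have c1 := c_le1; nra.
by rewrite -/q lerD2l lerN2 ler_pM2l.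
Qed.

Lemma Vc_Fc_smooth_e a b x : Vc c k (b + x) + a%:R * Fc c k (a + x) -
  b%:R * Fc c k (a + x).+1 <= (1 - c / expR 1)^-1 * Vc c k (a + x).
Proof.
by apply: le_trans (Vc_Fc_smooth a b x) _; rewrite ler_wpM2r ?Vc_ge0 ?rho_le.
Qed.

End BasisUtility.

Local Notation eta := Defs.eta.

(** * Admissible welfare functions as nonnegative combinations of the [Vc c k] *)

Section Decomposition.
Context {R : realType}.
Variables (c : R) (n : nat) (W : nat -> R).
Hypotheses (c_gt0 : 0 < c) (n_ge2 : (2 <= n)%N) (W_adm : admissible c n W).

Let c_neq0 : c != 0. Proof. by rewrite gt_eqF. Qed.

Let eta_preE k : (0 < k)%N ->
  eta_pre c W k = (2 * W k - W k.-1 - W k.+1) / c.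
Proof.
case: W_adm => W0 _ _ _ _; case: k => [//|[|k]] _; rewrite /eta_pre//=.
by rewrite W0 subr0.
Qed.

Let sum_eta_pre :
  \sum_(1 <= j < n) eta_pre c W j = (W 1%N - (W n - W n.-1)) / c.
Proof.
have [W0 _ _ _ _] := W_adm.
rewrite (@telescope_sumr_eq _ 1 n (fun j => - (W j - W j.-1) / c)).
- by rewrite /= W0; ring.
- exact: ltnW.
- by move=> k /andP[k0 _]; rewrite eta_preE//=; ring.
Qed.

(** For [k < n] this is concavity; for [k = n] the sum telescopes and the claim becomes the
    curvature bound. *)
Lemma eta_ge0 k : (1 <= k < n.+1)%N -> 0 <= eta c n W k.
Proof.
have [W0 Wpos _ Wconc Wcurv] := W_adm; move=> /andP[k0 kn].
rewrite /eta; case: eqP => _.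
  have W1 : 0 < W 1%N by exact: Wpos.
  rewrite sum_eta_pre subr_ge0 ler_pdivrMr//.
  rewrite mulrC -ler_pdivrMr// mulrBl mulfV// gt_eqF//.
rewrite eta_preE// mulr_ge0 ?invr_ge0 ?(ltW c_gt0)//.
case: k k0 kn => // k _ _ /=.
by have h := Wconc k; lra.
Qed.

(** [Vc c k] is piecewise linear, with a single kink at [k] where the slope drops by [c]. *)
Let Vc_diff2 k x : (0 < k)%N ->
  Vc c k x.+2 = 2 * Vc c k x.+1 - Vc c k x - c * (k == x.+1)%:R.
Proof.
move=> k0; rewrite /Vc -(@natr1 _ x.+1) -(@natr1 _ x).
have [xk|kx|<-] := ltngtP x.+1 k.
- rewrite (minn_idPl xk) (minn_idPl (ltnW (ltnW xk))).
  by rewrite -(@natr1 _ x.+1) -(@natr1 _ x) mulr0n; ring.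
- by rewrite (minn_idPr (leqW (ltnW kx))) (minn_idPr (ltnSE kx)) mulr0n; ring.
- rewrite (minn_idPr (leqnSn _)) (minn_idPl (leqnSn _)).
  by rewrite -(@natr1 _ x) mulr1n; ring.
Qed.

(** Both sides agree at 0 and, by the choice of [eta_n], at 1. Their second differences agree as
    well, since only [Vc c k] has a kink at [k] and [eta_k] is the second difference of [W] at [k]
    divided by [-c]. *)
Lemma eta_decomposition x : (x <= n)%N ->
  \sum_(1 <= k < n.+1) eta c n W k * Vc c k x = W x.
Proof.
have [W0 Wpos _ _ _] := W_adm.
have S0 : \sum_(1 <= k < n.+1) eta c n W k * Vc c k 0 = W 0%N.
  by rewrite W0 big1// => k _; rewrite /Vc min0n !mulr0 addr0 mulr0.
have S1 : \sum_(1 <= k < n.+1) eta c n W k * Vc c k 1 = W 1%N.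
  under eq_big_nat => k /andP[k0 _] do
    rewrite /Vc (minn_idPl k0) !mulr1 subrK mulr1.
  rewrite big_nat_recr ?(ltnW n_ge2)//= {2}/eta eqxx addrC -addrA.
  rewrite -[RHS]addr0; congr (_ + _); rewrite addrC; apply/eqP.
  rewrite subr_eq0; apply/eqP; apply: eq_big_nat => k /andP[_ kn].
  by rewrite /eta ltn_eqF.
have S2 y : (y.+2 <= n)%N ->
  \sum_(1 <= k < n.+1) eta c n W k * Vc c k y = W y ->
  \sum_(1 <= k < n.+1) eta c n W k * Vc c k y.+1 = W y.+1 ->
  \sum_(1 <= k < n.+1) eta c n W k * Vc c k y.+2 = W y.+2.
  move=> yn Sy Sy1.
  have -> : \sum_(1 <= k < n.+1) eta c n W k * Vc c k y.+2 =
      2 * (\sum_(1 <= k < n.+1) eta c n W k * Vc c k y.+1) -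
      (\sum_(1 <= k < n.+1) eta c n W k * Vc c k y) -
      c * \sum_(1 <= k < n.+1 | k == y.+1) eta c n W k.
    rewrite [X in c * X]big_mkcond !mulr_sumr -!sumrB; apply: eq_big_nat => k /andP[k0 _].
    by rewrite Vc_diff2//; case: eqP => _ /=; ring.
  rewrite Sy Sy1 big_nat1_eq /= ltnS (ltnW yn) /eta ltn_eqF// eta_preE//=.
  by field.
elim/ltn_ind: x => -[|[|x]]// IH xn.
by apply: S2 => //; apply: IH => //; rewrite ltnW// ltnW.
Qed.

Hypothesis c_le1 : c <= 1.

Lemma mech_smooth a b x : (b + x <= n)%N -> (a + x <= n)%N ->
  W (b + x) + a%:R * mech c n W (a + x) - b%:R * mech c n W (a + x).+1 <=
  (1 - c / expR 1)^-1 * W (a + x).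
Proof.
move=> bxn axn; rewrite -(eta_decomposition bxn) -(eta_decomposition axn).
rewrite /mech !mulr_sumr -big_split -sumrB; apply: ler_sum_nat => k kn /=.
have k0 : (0 < k)%N by case/andP: kn.
rewrite !(mulrCA _ (eta c n W k)) -mulrDr -mulrBr ler_wpM2l ?eta_ge0//.
exact: Vc_Fc_smooth_e.
Qed.

End Decomposition.

(** * Smoothness bounds the price of anarchy from below *)

Section Games.
Context {R : realType} {m : nat} {Rs : finType}.
Implicit Types (a e o : {ffun 'I_m -> {set Rs}}) (W F : Rs -> nat -> R).

Lemma load_upd a i (S : {set Rs}) r : r \in S ->
  load (upd a i S) r = (load a r + (r \notin a i))%N.
Proof.
move=> rS; rewrite /load (cardsD1 i) [in RHS](cardsD1 i) !inE ffunE eqxx rS.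
have -> : ([set j | r \in upd a i S j] :\ i = [set j | r \in a j] :\ i)%SET.
  by apply/setP => j; rewrite !inE ffunE; case: eqP.
by case: (r \in a i) => /=; rewrite ?addn0 ?add0n ?addn1 ?add1n.
Qed.

Lemma load0 a r : ~~ [exists i, r \in a i] -> load a r = 0%N.
Proof.
rewrite negb_exists => /forallP no_user.
by apply/eqP; rewrite cards_eq0; apply/eqP/setP => i; rewrite !inE; apply/negbTE.
Qed.

Lemma load_le a r : (load a r <= m)%N.
Proof. by rewrite -[leqRHS]card_ord max_card. Qed.

Lemma welfareE W a : (forall r, W r 0%N = 0) ->
  welfare W a = \sum_r W r (load a r).
Proof. by move=> W0; apply: big_rmcond => r /load0 ->. Qed.

Lemma sum_utility F a : \sum_i utility F a i = \sum_r (load a r)%:R * F r (load a r).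
Proof.
rewrite /utility (exchange_big_dep predT)//=; apply: eq_bigr => r _.
by rewrite sumr_const mulr_natl /load cardsE.
Qed.

(** A deviating player finds the old load on a resource already used in [e], and one more on a new
    one. *)
Lemma sum_deviation F e o : \sum_i utility F (upd e i (o i)) i =
  \sum_r (#|[set i | r \in e i & r \in o i]|%:R * F r (load e r) +
          #|[set i | r \notin e i & r \in o i]|%:R * F r (load e r).+1).
Proof.
have -> : \sum_i utility F (upd e i (o i)) i =
    \sum_i \sum_(r in o i) F r (load e r + (r \notin e i))%N.
  apply: eq_bigr => i _; rewrite /utility ffunE eqxx.
  by apply: eq_bigr => r ro; rewrite load_upd.
rewrite (exchange_big_dep predT)//=; apply: eq_bigr => r _.
rewrite (bigID (fun i => r \in e i)) /=; congr (_ + _).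
  rewrite (eq_bigr (fun=> F r (load e r))); last first.
    by move=> i /andP[_ ->]; rewrite addn0.
  by rewrite sumr_const mulr_natl cardsE; congr (_ *+ _); apply: eq_card => i; exact: andbC.
rewrite (eq_bigr (fun=> F r (load e r).+1)); last first.
  by move=> i /andP[_ ->]; rewrite addn1.
by rewrite sumr_const mulr_natl cardsE; congr (_ *+ _); apply: eq_card => i; exact: andbC.
Qed.

Variables (W F : Rs -> nat -> R) (mu : R) (A : 'I_m -> {set {set Rs}}).
Hypotheses (W0 : forall r, W r 0%N = 0)
  (smooth : forall r (a b x : nat), (b + x <= m)%N -> (a + x <= m)%N ->
     W r (b + x)%N + a%:R * F r (a + x)%N - b%:R * F r (a + x).+1 <=
     mu * W r (a + x)%N).

(** Summing the equilibrium inequalities for the deviations to [o] gives a nonnegative quantity;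
    added to [welfare W o], it is bounded resource by resource through [smooth]. Here [x] counts the
    users in both allocations, [a] those only in [e], [b] those only in [o]. *)
Lemma smooth_NE e o : is_NE A F e -> feasible A o ->
  welfare W o <= mu * welfare W e.
Proof.
move=> /andP[_ /forallP NEe] /forallP feas_o.
have dev : \sum_i utility F (upd e i (o i)) i <= \sum_i utility F e i.
  by apply: ler_sum => i _; have /forallP/(_ (o i))/implyP := NEe i; exact.
rewrite sum_deviation sum_utility -subr_ge0 in dev.
suff : welfare W o + (\sum_r (load e r)%:R * F r (load e r) -
    \sum_r (#|[set i | r \in e i & r \in o i]|%:R * F r (load e r) +
            #|[set i | r \notin e i & r \in o i]|%:R * F r (load e r).+1)) <=
    mu * welfare W e.
  by apply: le_trans; rewrite lerDl.
rewrite !welfareE// -sumrB -big_split mulr_sumr; apply: ler_sum => r _ /=.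
set x := #|[set i | r \in e i & r \in o i]|.
set b := #|[set i | r \notin e i & r \in o i]|.
pose a := #|[set i | r \in e i & r \notin o i]|.
have eE : load e r = (a + x)%N.
  rewrite /load -(cardsID [set i | r \in o i]) addnC; congr (_ + _)%N;
  by apply: eq_card => i; rewrite !inE// andbC.
have oE : load o r = (b + x)%N.
  rewrite /load -(cardsID [set i | r \in e i]) addnC; congr (_ + _)%N;
  by apply: eq_card => i; rewrite !inE// andbC.
have := @smooth r a b x; rewrite -eE -oE !load_le => /(_ isT isT).
apply: le_trans; rewrite eE natrD; lra.
Qed.

Lemma smooth_PoA : 1 <= mu -> (forall r x, 0 <= W r x) -> mu^-1 <= PoA A W F.
Proof.
move=> mu1 W_ge0; have mu0 : 0 < mu by exact: lt_le_trans mu1.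
have welfare_ge0 a : 0 <= welfare W a by exact: sumr_ge0.
have opt_ge0 : 0 <= opt_welfare A W.
  by rewrite /opt_welfare; elim/big_ind: _ => // x y x0 y0; rewrite le_max x0.
rewrite /PoA; case: eqVneq => [_|opt_neq0]; first by rewrite invf_le1.
have opt_gt0 : 0 < opt_welfare A W by rewrite lt_def opt_neq0.
(* The first case is the default of the minimum, [opt_welfare A W], for which [1 <= mu] suffices. *)
rewrite ler_pdivlMr//; apply: le_bigmin => [|e NEe].
  by rewrite ler_piMl// invf_le1.
rewrite ler_pdivrMl//; apply: bigmax_le => [|o feas_o]; first by rewrite mulr_ge0 ?(ltW mu0).
exact: smooth_NE.
Qed.

End Games.

(** * Upper bounds on the price of anarchy and the worst-case game *)

Lemma PoA_le {R : realType} (m : nat) (Rs : finType) (A : 'I_m -> {set {set Rs}})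
    (W F : Rs -> nat -> R) (e o : {ffun 'I_m -> {set Rs}}) :
  is_NE A F e -> feasible A o -> 0 <= welfare W e -> 0 < welfare W o ->
  PoA A W F <= welfare W e / welfare W o.
Proof.
move=> NEe feas_o e_ge0 o_gt0.
have o_le : welfare W o <= opt_welfare A W by apply: (bigmax_sup o).
have opt_gt0 := lt_le_trans o_gt0 o_le.
rewrite /PoA gt_eqF// (@le_trans _ _ (welfare W e / opt_welfare A W))//.
  by rewrite ler_pM2r ?invr_gt0//; apply: (bigmin_inf e).
by rewrite ler_wpM2l// lef_pV2.
Qed.

(* A game in which every load-dependent utility [f] makes [wc_bad] an
   equilibrium. The players are arranged on the cycle Z/(n+1); a resource of
   level [j] placed at [p] is used in [wc_bad] by the [j] players
   p, p+1, ..., p+j-1, and in [wc_good] by the next player p+j alone (by nobody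
   if [j] is the number of players). The multiplicities [N!/j!] of the levels,
   where [N = n.+1], make the two actions of a player equally good in [wc_bad]. *)
Section WorstCaseGame.
Variable n : nat.
Let N := n.+1.

Definition copies (j : nat) : nat := N ^_ (N - j).

Definition wc_resource : finType :=
  {j : 'I_N.+1 & ('I_N * 'I_(copies j))%type}.

Definition wc_level (r : wc_resource) : 'I_N.+1 := tag r.

(** The subtraction is cyclic: this is the number of steps from the place of [r] forward to [i]. *)
Definition wc_dist (i : 'I_N) (r : wc_resource) : 'I_N := i - (tagged r).1.

Definition wc_bad : {ffun 'I_N -> {set wc_resource}} :=
  [ffun i => [set r | (wc_dist i r < wc_level r)%N]%SET].

Definition wc_good : {ffun 'I_N -> {set wc_resource}} :=
  [ffun i => [set r | wc_dist i r == wc_level r :> nat]%SET].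

Definition wc_actions (i : 'I_N) : {set {set wc_resource}} :=
  [set wc_bad i; wc_good i]%SET.

Lemma copiesS j : (j < N)%N -> copies j = (copies j.+1 * j.+1)%N.
Proof.
move=> jN; have Nj : (N - j = (N - j.+1).+1)%N by rewrite subnSK.
by rewrite /copies Nj ffactnSr subKn.
Qed.

Lemma copies_fact j : (j <= N)%N -> (copies j * j`! = N`!)%N.
Proof. by move=> jN; rewrite /copies -(ffact_fact (leq_subr j N)) subKn. Qed.

Lemma card_ord_lt j : (j <= N)%N -> #|[pred d : 'I_N | (d < j)%N]| = j.
Proof.
move=> jN; rewrite -sum1_card.
by rewrite -(big_ord_widen N (fun=> 1%N) jN) sum1_card card_ord.
Qed.

Lemma card_ord_eq j : #|[pred d : 'I_N | d == j :> nat]| = (j < N)%N.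
Proof.
by rewrite -sum1_card (big_ord1_eq _ (fun=> 1%N)); case: ifP.
Qed.

Lemma card_wc_dist (P : pred nat) r :
  #|[set i | P (wc_dist i r)]%SET| = #|[pred d : 'I_N | P d]|.
Proof.
rewrite -!sum1_card [RHS](reindex_inj (subIr (tagged r).1)).
by apply: eq_bigl => i; rewrite inE.
Qed.

Lemma load_wc_bad r : load wc_bad r = wc_level r.
Proof.
have := card_wc_dist (fun d => d < wc_level r)%N r.
rewrite (card_ord_lt (ltnSE (ltn_ord (wc_level r)))) => <-.
by apply: eq_card => i; rewrite !inE ffunE inE.
Qed.

Lemma load_wc_good r : load wc_good r = (wc_level r < N)%N.
Proof.
have := card_wc_dist (fun d => d == wc_level r) r; rewrite card_ord_eq => <-.
by apply: eq_card => i; rewrite !inE ffunE inE.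
Qed.

Context {R : realType}.

(** For a fixed player [i], the map sending a place [p] to [i - p] is a bijection of the cycle, so
    counting places amounts to counting distances. *)
Lemma sum_wc (P : nat -> nat -> bool) (G : nat -> R) i :
  \sum_(r | P (wc_level r) (wc_dist i r)) G (wc_level r) =
  \sum_(j < N.+1) G j *+ (copies j * #|[pred d : 'I_N | P j d]|).
Proof.
rewrite -(@sig_big_dep _ _ _ 'I_N.+1 (fun j => ('I_N * 'I_(copies j))%type) predT
  (fun j x => P j (i - x.1)%R) (fun j _ => G j)).
apply: eq_bigr => j _.
rewrite (eq_bigl (fun x : 'I_N * 'I_(copies j) => P j (i - x.1)%R && true));
  last by move=> x; rewrite andbT.
rewrite -(pair_big_dep (fun p => P j (i - p)%R) (fun _ _ => true) (fun _ _ => G j)).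
under eq_bigr do rewrite sumr_const card_ord.
rewrite (reindex_inj (subrI i)).
by under eq_bigl do rewrite subKr; rewrite sumr_const mulrnA.
Qed.

Lemma wc_bad_NE (f : nat -> R) : is_NE wc_actions (fun=> f) wc_bad.
Proof.
apply/andP; split; first by apply/forallP => i; rewrite !inE eqxx.
apply/forallP => i; apply/forallP => T; apply/implyP; rewrite !inE => /orP[]/eqP->.
  suff -> : upd wc_bad i (wc_bad i) = wc_bad by [].
  by apply/ffunP => k; rewrite ffunE; case: eqP => [->|].
have -> : utility (fun=> f) wc_bad i =
    \sum_(r | (wc_dist i r < wc_level r)%N) f (wc_level r).
  rewrite /utility; apply: eq_big => [r|r _]; last by rewrite load_wc_bad.
  by rewrite ffunE inE.
have -> : utility (fun=> f) (upd wc_bad i (wc_good i)) i =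
    \sum_(r | wc_dist i r == wc_level r :> nat) f (wc_level r).+1.
  rewrite /utility ffunE eqxx; apply: eq_big => [r|r]; first by rewrite ffunE inE.
  move=> r_good; rewrite load_upd// load_wc_bad ffunE inE.
  by rewrite ffunE inE in r_good; rewrite (eqP r_good) ltnn addn1.
rewrite (sum_wc (fun j d => d < j)%N) (sum_wc (fun j d => d == j) (f \o succn)).
(* The top level drops out of [wc_good] and level 0 out of [wc_bad]. Level [j] of the first then
   matches level [j + 1] of the second, both with utility [f (j + 1)], and [copiesS] equates the
   multiplicities. *)
rewrite big_ord_recr [leRHS]big_ord_recl /= card_ord_eq ltnn muln0 mulr0n addr0.
rewrite card_ord_lt// muln0 mulr0n add0r ler_sum// => j _.
by rewrite card_ord_eq card_ord_lt ?ltn_ord//= muln1 copiesS.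
Qed.

Lemma sum_wc_all (G : nat -> R) :
  \sum_r G (wc_level r) = N%:R * N`!%:R * \sum_(j < N.+1) G j / j`!%:R.
Proof.
rewrite (sum_wc (fun _ _ => true) G ord0) mulr_sumr; apply: eq_bigr => j _.
have -> : #|[pred d : 'I_N | true]| = N by rewrite card_ord.
rewrite -(copies_fact (ltnSE (ltn_ord j))) -mulr_natr !natrM.
by field; rewrite gt_eqF ?fact_gt0R.
Qed.

Variable c : R.
Hypotheses (c_gt0 : 0 < c) (c_le1 : c <= 1).

Lemma Vc1_admissible m : (2 <= m)%N -> admissible c m (Vc c 1).
Proof.
move=> m2; have c0 := c_gt0; have c1 := c_le1.
have V0 : Vc c 1 0 = 0 by rewrite /Vc min0n !mulr0 addr0.
have VS x : Vc c 1 x.+1 = (1 - c) * x%:R + 1.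
  by rewrite /Vc (minn_idPr _)// -natr1; ring.
split=> [//|x x0|x|x|].
- by rewrite -(prednK x0) VS ltr_wpDl// mulr_ge0// subr_ge0.
- case: x => [|x]; first by rewrite V0 VS mulr0 add0r.
  by rewrite !VS -(@natr1 _ x) mulrDr lerD2r lerDl mulr1 subr_ge0.
- case: x => [|x]; first by rewrite V0 !VS; lra.
  by rewrite !VS -(@natr1 _ x.+1) -(@natr1 _ x) le_eqVlt; apply/orP; left; apply/eqP; ring.
- case: m m2 => [|[|m]]// _; rewrite !VS mulr0 add0r divr1 -natr1.
  by rewrite le_eqVlt; apply/orP; left; apply/eqP; ring.
Qed.

(** With [S] the sum of [1/j!] over [j < N], the ratio of the two welfares is
    [1 - c * (1 - 1/N!) / S]; the bound follows from [1 <= S <= e]. *)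
Lemma wc_PoA_le (f : nat -> R) :
  PoA wc_actions (fun=> Vc c 1) (fun=> f) <=
  1 - c / expR 1 + (N`!%:R)^-1.
Proof.
have [V0 _ _ _ _] := @Vc1_admissible 2 isT.
have V1 : Vc c 1 1 = 1 by rewrite /Vc minnn; ring.
pose S : R := exp_partial 1 N.
have S_ge1 : 1 <= S.
  rewrite /S /exp_partial big_nat_recl//= expr0 divr1 lerDl.
  by apply: sumr_ge0 => j _; rewrite divr_ge0 ?exprn_ge0.
have sumS : S = \sum_(j < N) (j`!%:R)^-1.
  rewrite /S /exp_partial big_mkord; apply: eq_bigr => j _.
  by rewrite expr1n div1r.
have NN : 0 < N%:R * N`!%:R :> R by rewrite mulr_gt0 ?fact_gt0R.
have good : welfare (fun=> Vc c 1) wc_good = N%:R * N`!%:R * S.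
  rewrite welfareE//; under eq_bigr do rewrite load_wc_good.
  rewrite (sum_wc_all (fun j => Vc c 1 (j < N)%N)) big_ord_recr /= ltnn V0 mul0r addr0.
  congr (_ * _); rewrite sumS; apply: eq_bigr => j _.
  by rewrite ltn_ord V1 div1r.
have bad : welfare (fun=> Vc c 1) wc_bad =
    N%:R * N`!%:R * (S - c * (1 - (N`!%:R)^-1)).
  rewrite welfareE//; under eq_bigr do rewrite load_wc_bad.
  rewrite sum_wc_all; congr (_ * _).
  (* Level 0 contributes nothing, and [Vc c 1 (j+1) / (j+1)!] equals [(1 - c) / j! + c / (j+1)!]. *)
  have -> : \sum_(j < N.+1) Vc c 1 j / j`!%:R =
      (1 - c) * (\sum_(j < N) (j`!%:R)^-1) + c * \sum_(j < N) (j.+1`!%:R)^-1.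
    rewrite big_ord_recl V0 mul0r add0r !mulr_sumr -big_split; apply: eq_bigr => j _.
    rewrite /= /bump /= add1n /Vc (minn_idPr _)// factS natrM.
    have f0 := @fact_gt0R R j; have j0 : 0 < j.+1%:R :> R by rewrite ltr0n.
    by move: j0; move: (j.+1%:R) => y j0; field; rewrite !gt_eqF.
  have -> : \sum_(j < N) (j.+1`!%:R)^-1 = S - 1 + (N`!%:R)^-1 :> R.
    have : \sum_(j < N.+1) (j`!%:R)^-1 = S + (N`!%:R)^-1 :> R.
      by rewrite big_ord_recr sumS.
    by rewrite big_ord_recl /= fact0 invr1 => /(canRL (addKr _)) ->; ring.
  by rewrite -sumS; ring.
have S_gt0 : 0 < S by exact: lt_le_trans S_ge1.
apply: le_trans (@PoA_le _ _ _ _ _ _ wc_bad wc_good _ _ _ _) _.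
- exact: wc_bad_NE.
- by apply/forallP => i; rewrite !inE eqxx orbT.
- rewrite bad mulr_ge0 ?(ltW NN)// subr_ge0 (le_trans _ S_ge1)//.
  rewrite mulr_ile1 ?(ltW c_gt0)// ?gerBl ?invr_ge0//.
  by rewrite subr_ge0 invf_le1 ?fact_gt0R// ler1n fact_gt0.
- by rewrite good mulr_gt0.
rewrite good bad -mulf_div divff ?gt_eqF// mul1r mulrBl divff ?gt_eqF//.
rewrite -addrA lerD2l.
have S_le : S <= expR 1 by exact: exp_partial_le.
have Sinv : (expR 1)^-1 <= S^-1 by rewrite lef_pV2 ?posrE ?expR_gt0 ?S_gt0.
have Sinv1 : S^-1 <= 1 by rewrite invf_le1.
have Sinv0 : 0 < S^-1 by rewrite invr_gt0.
have f0 : 0 < (N`!%:R)^-1 :> R by rewrite invr_gt0 fact_gt0R.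
have cS : c * S^-1 <= 1 by rewrite mulr_ile1 ?(ltW c_gt0) ?(ltW Sinv0).
have ce : c / expR 1 <= c * S^-1 by rewrite ler_pM2l.
move: cS ce f0; move: (N`!%:R)^-1 (c / expR 1) => y z cS ce y0.
have -> : c * (1 - y) / S = c * S^-1 - (c * S^-1) * y by ring.
by nra.
Qed.

End WorstCaseGame.

(** * Assembling the two bounds *)

Theorem theorem1 (R : realType) (c : R) (hc0 : 0 < c) (hc1 : c <= 1) :
  (* (a) *)
  (forall n : nat, (2 <= n)%N ->
     forall (m : nat) (Rs : finType) (A : 'I_m -> {set {set Rs}}) (W : Rs -> nat -> R),
       (m <= n)%N ->
       (forall i, A i != finset.set0) ->
       (forall r, admissible c n (W r)) ->
       1 - c / expR 1 <= PoA A W (fun r => mech c n (W r)))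
  /\
  (* (b) *)
  (forall Fm : (nat -> R) -> (nat -> R),
     inf [set x : R | exists (m : nat) (Rs : finType) (A : 'I_m -> {set {set Rs}})
                              (W : Rs -> nat -> R),
                        [/\ (2 <= m)%N, (forall i, A i != finset.set0),
                            (forall r, admissible c m (W r)) &
                            x = PoA A W (fun r => Fm (W r))]]
     <= 1 - c / expR 1).
Proof.
have e_gt1 : 1 < expR 1 :> R by rewrite expR_gt1.
have ce_lt1 : c / expR 1 < 1.
  by rewrite ltr_pdivrMr ?expR_gt0// mul1r (le_lt_trans hc1).
have ce_gt0 : 0 < c / expR 1 by rewrite divr_gt0 ?expR_gt0.
split=> [n n2 m Rs A W mn _ W_adm | Fm].
  rewrite -[leLHS]invrK; apply: smooth_PoA.
  - by move=> r; have [] := W_adm r.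
  - move=> r a b x bx ax.
    by apply: mech_smooth => //; exact: leq_trans mn.
  - by rewrite invf_ge1 ?subr_gt0// gerBl ltW.
  - move=> r x; have [W0 Wpos _ _ _] := W_adm r.
    by case: x => [|x]; [rewrite W0 | exact: ltW (Wpos _ _)].
set E := (X in inf X).
have [hi|] := pselect (has_inf E); last first.
  (* [inf] takes the junk value 0 here *)
  by move/inf_out ->; rewrite subr_ge0 ltW.
apply/ler_addgt0Pr => eps eps_gt0.
(* With [N = n + 1] players, [N! >= N >= 1/eps] makes the error term at most [eps]; the successor
   ensures [N >= 2]. *)
pose n := (Num.bound eps^-1).+1.
have n_large : (n.+1`!%:R)^-1 <= eps :> R.
  rewrite -[leRHS]invrK lef_pV2 ?posrE ?invr_gt0 ?fact_gt0R//.
  apply: le_trans (ltW (archi_boundP _)) _; first by rewrite invr_ge0 ltW.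
  rewrite ler_nat (leq_trans _ (fact_geq _))// /n.
  by rewrite ltnW// ltnW.
apply: le_trans (ge_inf hi.2 _) _; last first.
  apply: le_trans (wc_PoA_le n hc0 hc1 (Fm (Vc c 1))) _.
  by rewrite lerD2l.
exists n.+1, (wc_resource n), (@wc_actions n), (fun=> Vc c 1); split=> // [i|r].
- by apply/set0Pn; exists (wc_bad n i); rewrite !inE eqxx.
- exact: Vc1_admissible.
Qed.
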